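(* The embedding $H_{W,V}(\mathbb{T})\hookrightarrow L^{2}_{V}(\mathbb{T})$ is compact, where $H_{W,V}(\mathbb{T})$ carries the norm $\|\cdot\|_{1,2}$.
   Context: Setting. $\mathbb{T}=\mathbb{R}/\mathbb{Z}$, identified with $[0,1)$ with tagged point $0$. Càdlàg = right-continuous with left limits; càglàd = left-continuous with right limits. $W,V:\mathbb{R}\to\mathbb{R}$ are strictly increasing, $W$ càdlàg, $V$ càglàd, with $W(x+1)-W(x)=W(1)-W(0)$ and $V(x+1)-V(x)=V(1)-V(0)$ for all $x$; both are continuous at $0$ and $W(0)=V(0)=0$. They induce finite Borel measures on $\mathbb{T}$ with $dW((a,b])=W(b)-W(a)$, $dV([a,b))=V(b)-V(a)$ (atoms allowed). $L^2_V,L^2_W$ are the corresponding $L^2$ spaces with norms $\|\cdot\|_V,\|\cdot\|_W$. One-sided derivatives: $D_W^-f(x)=\lim_{h\to0^-}\frac{f(x+h)-f(x)}{W(x+h)-W(x)}$, $D_V^+g(x)=\lim_{h\to0^+}\frac{g(x+h)-g(x)}{V(x+h)-V(x)}$, required to exist at every $x\in\mathbb{T}$. $\mathfrak{D}_{W,V}(\mathbb{T})$ is the set of càdlàg $f:\mathbb{T}\to\mathbb{R}$ such that $D_W^-f$ exists and is càglàd and $D_V^+D_W^-f$ exists and is càdlàg. On it put $\|f\|_{1,2}^2=\langle f-D_V^+D_W^-f,f\rangle_V=\|f\|_V^2+\|D_W^-f\|_W^2$. $H_{W,V}(\mathbb{T})$ (the energetic space of $I-D_V^+D_W^-$) is the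 set of $f\in L^2_V(\mathbb{T})$ for which there is a sequence $f_n\in\mathfrak{D}_{W,V}(\mathbb{T})$ with $f_n\to f$ in $L^2_V(\mathbb{T})$ and $(f_n)$ Cauchy for $\|\cdot\|_{1,2}$; the norm extends by $\|f\|_{1,2}=\lim_n\|f_n\|_{1,2}$. *)

(* Defs.v *)
From HB Require Import structures.
From mathcomp Require Import all_boot all_order all_algebra.
From mathcomp Require Import all_classical all_reals all_analysis.

Set Implicit Arguments.
Unset Strict Implicit.
Unset Printing Implicit Defensive.
Import Order.TTheory GRing.Theory Num.Theory.
Import numFieldNormedType.Exports.
Local Open Scope classical_set_scope.
Local Open Scope ring_scope.

(* A function on the torus R/Z is a 1-periodic function R -> R; a measure on the
   torus is a measure on R carried by the fundamental domain [0, 1), so that L^p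
   classes on R for it are L^p classes on the torus. *)

(* The library defines L^p as a quotient of functions but gives it no topology;
   here it receives the one of the metric |f - g|_p. *)
Section lspace_metric.
Context d (T : measurableType d) (R : realType).
Variables (mu : {measure set T -> \bar R}) (p : \bar R) (p1 : (1 <= p)%E).

HB.instance Definition _ := gen_eqMixin (LspaceType mu p1).
HB.instance Definition _ := gen_choiceMixin (LspaceType mu p1).

Definition Lspace_dist (f g : LspaceType mu p1) : R :=
  fine ('N[mu]_p[EFin \o ((f : T -> R) \- (g : T -> R))%R])%E.

Lemma Lspace_Lfun (f : LspaceType mu p1) : (f : T -> R) \in Lfun mu p.
Proof.
rewrite inE; apply/andP; split; rewrite inE/=; last exact: Lebesgue_finite.
have := @measurable_funP _ _ _ _ setT (repr (LebesgueSpace.sort f)); exact.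
Qed.

Lemma Lspace_eq (f g : LspaceType mu p1) :
  (f : T -> R) = g %[ae mu] -> f = g.
Proof.
move=> fg.
have : (f : {mfun_ mu, T >-> measurableTypeR R}) = g.
  apply/eqP; rewrite -[X in X == _]reprK -[X in _ == X]reprK.
  by apply/eqP/eqmodP/asboolP.
case: f g {fg} => f [[Pf]] [g [[Pg]]] /= fg; subst g.
by rewrite (Prop_irrelevance Pf Pg).
Qed.

Let sub (f g : LspaceType mu p1) : LfunType mu p1 :=
  Lfun_Sub p1 (Lspace_Lfun f) - Lfun_Sub p1 (Lspace_Lfun g).

Let distE (f g : LspaceType mu p1) :
  (Lspace_dist f g)%:E = ('N[mu]_p[EFin \o sub f g])%E.
Proof. by rewrite -finite_norm_fine. Qed.

Lemma Lspace_distxx f : Lspace_dist f f = 0.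
Proof.
apply/EFin_inj; rewrite distE /sub subrr.
by rewrite Lnorm0// gt_eqF// (lt_le_trans _ p1).
Qed.

Lemma Lspace_dist_positivity f g : Lspace_dist f g = 0 -> f = g.
Proof.
move=> fg0; have /fine_Lnormr_eq0 fg : fine ('N[mu]_p[EFin \o sub f g])%E = 0.
  by rewrite -distE /= fg0.
apply: Lspace_eq; apply: filterS fg => x /(_ Logic.I) /= fgx _.
by apply/eqP; rewrite -subr_eq0; apply/eqP.
Qed.

Lemma Lspace_dist_sym f g : Lspace_dist f g = Lspace_dist g f.
Proof.
rewrite /Lspace_dist -(LnormrN (sub f g)); congr (fine (Lnorm _ _ _)).
by apply/funext => x /=; rewrite opprB.
Qed.

Lemma Lspace_dist_triangle g f h :
  Lspace_dist f h <= Lspace_dist f g + Lspace_dist g h.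
Proof.
have := ler_LnormD (sub f g) (sub g h).
congr (fine (Lnorm _ _ _) <= _); apply/funext => x /=.
by rewrite addrA subrK.
Qed.

HB.instance Definition _ := isMetric.Build R (LspaceType mu p1)
  Lspace_distxx Lspace_dist_positivity Lspace_dist_sym Lspace_dist_triangle.

End lspace_metric.

Section one_sided.
Context {R : realType}.
Implicit Types F f : R -> R.

Definition cadlag f := forall x,
  f y @[y --> x^'+] --> f x /\ cvg (f y @[y --> x^'-]).

Definition caglad f := forall x,
  f y @[y --> x^'-] --> f x /\ cvg (f y @[y --> x^'+]).

Definition diff_quotient F f (x h : R) : R :=
  (f (x + h) - f x) / (F (x + h) - F x).

Definition left_derivable F f :=
  forall x, cvg (diff_quotient F f x h @[h --> 0^'-]).

Definition left_derivative F f (x : R) : R :=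
  lim (diff_quotient F f x h @[h --> 0^'-]).

Definition right_derivable F f :=
  forall x, cvg (diff_quotient F f x h @[h --> 0^'+]).

Definition right_derivative F f (x : R) : R :=
  lim (diff_quotient F f x h @[h --> 0^'+]).

(* The conditions shared by W and V; the increment condition makes the induced
   measure well defined on the torus. *)
Record integrator F : Prop := {
  integrator_increasing : {homo F : x y / x < y} ;
  integrator_increment : forall x, F (x + 1) - F x = F 1 - F 0 ;
  integrator_continuous0 : {for 0, continuous F} ;
  integrator0 : F 0 = 0 }.

End one_sided.

Section stieltjes.
Context {R : realType} (V : R -> R).
Hypotheses (iV : integrator V) (lV : caglad V).

(* Stieltjes measures are available for right-continuous functions only, so the
   measure of the left-continuous V is the image under x |-> - x of the one of
   x |-> - V (- x); dVE below checks the resulting normalization. *)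
Definition mirror (x : R) : R := - V (- x).

Lemma mirror_nondecreasing : nondecreasing mirror.
Proof.
move=> x y; rewrite le_eqVlt => /predU1P[->//|xy].
by rewrite /mirror lerN2 ltW// (integrator_increasing iV)// ltrN2.
Qed.

Lemma mirror_right_continuous : right_continuous mirror.
Proof.
move=> x; apply: (@cvgN _ R).
have [+ _] := lV (- x); apply: cvg_trans => /=.
by rewrite (_ : (fun y => V (- y)) = V \o -%R)// at_leftN.
Qed.

#[local] HB.instance Definition _ := isCumulative.Build R _ R mirror
  mirror_nondecreasing mirror_right_continuous.

Definition mirror_cumulative : cumulative R R := [the cumulative R R of mirror].

Definition dV (A : set (measurableTypeR R)) : \bar R :=
  lebesgue_stieltjes_measure mirror_cumulative (-%R @^-1` (A `&` `[0, 1[)).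

Let mN : measurable_fun [set: measurableTypeR R]
  (-%R : measurableTypeR R -> measurableTypeR R).
Proof. exact: measurable_realfun.oppr_measurable. Qed.

Let pre (A : set (measurableTypeR R)) : measurable A ->
  measurable (-%R @^-1` (A `&` `[0, 1[) : set (measurableTypeR R)).
Proof.
move=> mA; rewrite -[X in measurable X]setTI; apply: mN => //.
by apply: measurableI => //; exact: measurable_itv.
Qed.

Let dV0 : dV set0 = 0%E.
Proof. by rewrite /dV set0I preimage_set0 measure0. Qed.

Let dV_ge0 A : (0 <= dV A)%E.
Proof. exact: measure_ge0. Qed.

Let dV_sigma_additive : semi_sigma_additive dV.
Proof.
move=> F mF tF mUF; rewrite /dV setI_bigcupl preimage_bigcup.
apply: measure_semi_sigma_additive.
- by move=> n; exact: pre.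
- apply/trivIsetP => /= i j _ _ ij; rewrite -preimage_setI setIACA.
  by move/trivIsetP : tF => /(_ _ _ _ _ ij) ->//; rewrite set0I preimage_set0.
- by rewrite -preimage_bigcup -setI_bigcupl; exact: pre.
Qed.

HB.instance Definition _ := isMeasure.Build _ _ _ dV
  dV0 dV_ge0 dV_sigma_additive.

Lemma dVE (a b : R) : 0 <= a -> a <= b -> b <= 1 ->
  dV `[a, b[ = (V b - V a)%:E.
Proof.
move=> a0 ab b1; rewrite /dV.
rewrite (_ : _ @^-1` _ = `](- b), (- a)]%classic); last first.
  apply/seteqP; split=> x /=; rewrite !in_itv/=.
    by move=> [/andP[ax xb] _]; rewrite ltrNl xb lerNr.
  rewrite ltrNl lerNr => /andP[xb ax]; split; first by rewrite ax xb.
  by rewrite (le_trans a0 ax) (lt_le_trans xb b1).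
rewrite /lebesgue_stieltjes_measure /measure_extension.
rewrite measurable_mu_extE/=; last exact: is_ocitv.
by rewrite wlength_itv_bnd ?lerN2//= /mirror !opprK addrC.
Qed.

Let dV_fin : fin_num_fun dV.
Proof.
apply: lty_fin_num_fun.
suff : (dV setT < +oo)%E by [].
have -> : dV setT = dV `[0, 1[ by rewrite /dV setTI setIid.
by rewrite dVE// ltry.
Qed.

HB.instance Definition _ := Measure_isFinite.Build _ _ _ dV dV_fin.

End stieltjes.

Section energetic_space.
Context {R : realType} (W V : R -> R).
Hypotheses (iV : integrator V) (lV : caglad V).

Local Notation L2V := (LspaceType2 (dV iV lV)).
Local Notation DW := (left_derivative W).
Local Notation DV := (right_derivative V).

Record smooth (f : R -> R) : Prop := {
  smooth_periodic : periodic f 1 ;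
  smooth_cadlag : cadlag f ;
  smooth_left_derivable : left_derivable W f ;
  smooth_left_derivative : caglad (DW f) ;
  smooth_right_derivable : right_derivable V (DW f) ;
  smooth_right_derivative : cadlag (DV (DW f)) }.

Definition inner_V (f g : R -> R) : R := (\int[dV iV lV]_x (f x * g x))%R.

(* The energetic norm of I - D_V^+ D_W^-.  Its second expression, with square
   |f|_V^2 + |D_W^- f|_W^2, is an integration by parts and is not built in. *)
Definition smooth_norm (f : R -> R) : R :=
  Num.sqrt (inner_V (f \- DV (DW f)) f).

Definition approximates (f_ : nat -> R -> R) (u : L2V) : Prop :=
  [/\ forall n, smooth (f_ n),
      ('N[dV iV lV]_2[EFin \o (f_ n \- (u : R -> R))%R])%E @[n --> \oo] --> 0%E &
      forall e : R, 0 < e ->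
        \forall m & n \near \oo, smooth_norm (f_ m \- f_ n) < e].

Definition energetic_space : set L2V := [set u | exists f_, approximates f_ u].

(* The value is independent of the approximating sequence, so that selecting
   one by choice is harmless on energetic_space. *)
Definition energetic_norm (u : L2V) : R :=
  get [set r | exists2 f_, approximates f_ u &
                 smooth_norm (f_ n) @[n --> \oo] --> r].

End energetic_space.
Arguments energetic_space {R} W {V} iV lV.
Arguments energetic_norm {R} W {V} iV lV u.

(* H is a subset of X with its own norm N: the inclusion of H in X maps N-bounded
   sets to relatively compact sets. *)
Definition compact_embedding {R : realType} {X : topologicalType}
    (H : set X) (N : X -> R) : Prop :=
  forall B : set X, B `<=` H -> (exists M, forall u, B u -> N u <= M) ->
    precompact B.

(* Main.v *)
Require Import Defs.
From HB Require Import structures.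
From mathcomp Require Import all_boot all_order all_algebra.
From mathcomp Require Import all_classical all_reals all_analysis.
From mathcomp Require Import measurable_realfun ring lra.


(* Write g = D_W^- f and h = D_V^+ g for a smooth f.  A property of intervals
   that is additive and holds locally at both sides of every point holds on every
   interval.  Applied to a mean value inequality for one-sided quotients, this
   gives summation by parts with an error linear in W and V, hence
     (f y - f x)^2 / (W y - W x) <= - \int f h dV     for 0 <= x < y <= 1
   without introducing the measure dW.  Thus the energetic norm, whose square is
   \int f^2 dV - \int f h dV, is a seminorm on smooth functions, and a bound on it
   bounds f uniformly and makes it 1/2-Hoelder with respect to W.  As W has a finite
   e-net for every e, pointwise and uniform convergence agree on the set of such
   functions, so that an ultrafilter on it converges uniformly, hence in L^2_V. *)

Set Implicit Arguments.
Unset Strict Implicit.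
Unset Printing Implicit Defensive.
Import Order.TTheory GRing.Theory Num.Theory.
Import numFieldNormedType.Exports.
Local Open Scope classical_set_scope.
Local Open Scope ring_scope.

(** * Local-to-global arguments on intervals and mean value inequalities for one-sided quotients *)

Section intervals.
Context {R : realType}.
Implicit Types (P : set R) (x y z a b : R) (f F : R -> R).

Lemma near_leftP P x : (\forall y \near x^'-, P y) <->
  exists2 d, 0 < d & forall y, x - d < y -> y < x -> P y.
Proof.
split=> [[d /= d0 dP]|[d d0 dP]]; exists d => //= y.
  by move=> dy yx; apply: dP => //=; rewrite /ball /= gtr0_norm; lra.
by move=> + yx; rewrite /ball_ /= gtr0_norm ?subr_gt0// => dy; apply: dP => //; lra.
Qed.

Lemma near_rightP P x : (\forall y \near x^'+, P y) <->
  exists2 d, 0 < d & forall y, x < y -> y < x + d -> P y.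
Proof.
split=> [[d /= d0 dP]|[d d0 dP]]; exists d => //= y.
  by move=> dy yx; apply: dP => //=; rewrite /ball /= ltr0_norm; lra.
by move=> + yx; rewrite /ball_ /= ltr0_norm ?subr_lt0// => dy; apply: dP => //; lra.
Qed.

Lemma near_left_itv P x : (\forall y \near x^'-, P y) ->
  \forall y \near x^'-, forall z, y <= z -> z < x -> P z.
Proof.
move=> /near_leftP[d d0 dP]; apply/near_leftP; exists d => // y dy yx z yz zx.
by apply: dP => //; lra.
Qed.

Lemma near_right_itv P x : (\forall y \near x^'+, P y) ->
  \forall y \near x^'+, forall z, x < z -> z <= y -> P z.
Proof.
move=> /near_rightP[d d0 dP]; apply/near_rightP; exists d => // y dy yx z yz zx.
by apply: dP => //; lra.
Qed.

(** Supremum argument: the points [x] with [P a x] reach their supremum by the local property on its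
    left, and would pass it by the one on its right if it were below [b]. *)
Lemma interval_induction (P : R -> R -> Prop) a b : a < b ->
  (forall x y z, a <= x -> x < y -> y < z -> z <= b ->
    P x y -> P y z -> P x z) ->
  (forall x, a < x -> x <= b -> \forall y \near x^'-, P y x) ->
  (forall x, a <= x -> x < b -> \forall y \near x^'+, P x y) ->
  P a b.
Proof.
move=> ab Padd Pl Pr.
pose E := [set x | [/\ a < x, x <= b & P a x]].
have [d d0 dP] := (near_rightP _ _).1 (Pr a (lexx a) ab).
have [x0 Ex0] : exists x, E x.
  exists (Num.min b (a + d / 2)); rewrite /E/= lt_min ab ge_min lexx /=.
  split=> //; first by lra.
  by apply: dP; rewrite ?lt_min ?gt_min ?ab/=; [lra|apply/orP; right; lra].
have hE : has_sup E by split; [exists x0|exists b => x []].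
have ubE x : E x -> x <= sup E by apply/ub_le_sup; case: hE.
have as_ : a < sup E by apply: lt_le_trans (ubE _ Ex0); case: Ex0.
have sb : sup E <= b by apply: ge_sup; [exists x0|move=> x []].
have Pas : P a (sup E).
  have [e e0 eP] := (near_leftP _ _).1 (Pl _ as_ sb).
  have [t Et st] := sup_adherent e0 hE.
  have := ubE _ Et; rewrite le_eqVlt => /predU1P[<-|ts]; first by case: Et.
  case: Et => at_ tb Pat.
  have Pt : P t (sup E) by exact: eP.
  by apply: (Padd _ t) => //; rewrite ltW.
move: sb; rewrite le_eqVlt => /predU1P[<-//|sb].
have [e e0 eP] := (near_rightP _ _).1 (Pr _ (ltW as_) sb).
pose y := Num.min b (sup E + e / 2).
have sy : sup E < y by rewrite lt_min sb; lra.
have yb : y <= b by rewrite ge_min lexx.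
have : E y.
  split=> //; first lra; apply: (Padd _ (sup E)) => //.
  by apply: eP => //; rewrite gt_min; apply/orP; right; lra.
by move=> /ubE; lra.
Qed.

(** The comparison is local on the right only; at the supremum of the good points, left continuity
    of [f] replaces the missing one on the left. *)
Lemma nondecreasing_right_local f a b : a <= b ->
  (forall x, f y @[y --> x^'-] --> f x) ->
  (forall x, a <= x -> x < b -> \forall y \near x^'+, f x <= f y) ->
  f a <= f b.
Proof.
rewrite le_eqVlt => /predU1P[->//|ab] fl fr.
pose E := [set x | [/\ a <= x, x <= b & f a <= f x]].
have Ea : E a by split => //; exact: ltW.
have hE : has_sup E by split; [exists a|exists b => x []].
have ubE x : E x -> x <= sup E by apply/ub_le_sup; case: hE.
have as_ := ubE _ Ea.
have sb : sup E <= b by apply: ge_sup; [exists a|move=> x []].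
have fas : f a <= f (sup E).
  rewrite leNgt; apply/negP => fsa.
  have [e e0 eP] := (near_leftP _ _).1 (cvgr_lt _ (fl (sup E)) _ fsa).
  have [t Et st] := sup_adherent e0 hE.
  have [_ _] := Et; have := ubE _ Et; rewrite le_eqVlt => /predU1P[->|ts].
    by rewrite leNgt fsa.
  by rewrite leNgt eP.
move: sb; rewrite le_eqVlt => /predU1P[<-//|sb].
have [e e0 eP] := (near_rightP _ _).1 (fr _ as_ sb).
pose y := Num.min b (sup E + e / 2).
have sy : sup E < y by rewrite lt_min sb; lra.
have yb : y <= b by rewrite ge_min lexx.
have : E y.
  split=> //; first lra; apply: (le_trans fas); apply: eP => //.
  by rewrite gt_min; apply/orP; right; lra.
by move=> /ubE; lra.
Qed.

Lemma nonincreasing_left_local f a b : a <= b ->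
  (forall x, f y @[y --> x^'+] --> f x) ->
  (forall x, a < x -> x <= b -> \forall y \near x^'-, f x <= f y) ->
  f b <= f a.
Proof.
move=> ab fr fl.
have : (f \o -%R) (- b) <= (f \o -%R) (- a).
  apply: nondecreasing_right_local => [|x|x ax xb]; first by rewrite lerN2.
    by rewrite -[x in _ @ x^'-]opprK; apply/cvg_at_rightNP; exact: fr.
  have [d d0 dP] := (near_leftP _ _).1 (fl (- x) ltac:(lra) ltac:(lra)).
  apply/near_rightP; exists d => // y xy yx /=; apply: dP; lra.
by rewrite /= !opprK.
Qed.

(** As [F] increases, a left quotient below [c] says that [f - c * F] is larger just left of [x]
    than at [x]. Left quotients thus go with right continuity, as for W, and right quotients below
    with left continuity, as for V. *)
Lemma left_quotient_le F f c a b : a <= b -> {homo F : x y / x < y} ->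
  (forall x, F y @[y --> x^'+] --> F x) ->
  (forall x, f y @[y --> x^'+] --> f x) ->
  (forall x, a < x -> x <= b ->
    \forall h \near 0^'-, diff_quotient F f x h < c) ->
  f b - f a <= c * (F b - F a).
Proof.
move=> ab Finc Fr fr q.
suff : f b - c * F b <= f a - c * F a by lra.
apply: (@nonincreasing_left_local (fun x => f x - c * F x)) => // [x|x ax xb].
  by apply: cvgB => //; apply: cvgMr.
have [d d0 dP] := (near_leftP _ _).1 (q _ ax xb).
apply/near_leftP; exists d => // y dy yx.
have Fyx := Finc _ _ yx.
have := dP (y - x) ltac:(lra) ltac:(lra).
rewrite /diff_quotient subrKC ltr_ndivrMr; lra.
Qed.

Lemma right_quotient_le F f c a b : a <= b -> {homo F : x y / x < y} ->
  (forall x, F y @[y --> x^'-] --> F x) ->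
  (forall x, f y @[y --> x^'-] --> f x) ->
  (forall x, a <= x -> x < b ->
    \forall h \near 0^'+, diff_quotient F f x h < c) ->
  f b - f a <= c * (F b - F a).
Proof.
move=> ab Finc Fr fr q.
suff : c * F a - f a <= c * F b - f b by lra.
apply: (@nondecreasing_right_local (fun x => c * F x - f x)) => // [x|x ax xb].
  by apply: cvgB => //; apply: cvgMr.
have [d d0 dP] := (near_rightP _ _).1 (q _ ax xb).
apply/near_rightP; exists d => // y dy yx.
have Fyx := Finc _ _ dy.
have := dP (y - x) ltac:(lra) ltac:(lra).
rewrite /diff_quotient subrKC ltr_pdivrMr; lra.
Qed.

Lemma diff_quotientN F f x h :
  diff_quotient F (\- f) x h = - diff_quotient F f x h.
Proof. by rewrite /diff_quotient /= -mulNr; congr (_ / _); ring. Qed.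

(** The one-sided bound is applied to [f] with [c + e] and to [- f] with [- c + e]. *)
Lemma left_increment_approx F f c e a b : a <= b -> {homo F : x y / x < y} ->
  (forall x, F y @[y --> x^'+] --> F x) ->
  (forall x, f y @[y --> x^'+] --> f x) ->
  left_derivable F f ->
  (forall x, a < x -> x <= b -> `|left_derivative F f x - c| < e) ->
  `|f b - f a - c * (F b - F a)| <= e * (F b - F a).
Proof.
move=> ab Finc Fr fr df H.
have lo : f b - f a <= (c + e) * (F b - F a).
  apply: left_quotient_le => // x ax xb.
  apply: (cvgr_lt _ (df x)); have := H _ ax xb.
  by rewrite ltr_norml => /andP[_]; rewrite ltrBlDr addrC.
have up : (\- f) b - (\- f) a <= (- c + e) * (F b - F a).
  apply: left_quotient_le => // [x|x ax xb]; first exact: cvgN.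
  under eq_near do rewrite diff_quotientN ltrNl.
  apply: (cvgr_gt _ (df x)); have := H _ ax xb.
  rewrite ltr_norml => /andP[+ _]; rewrite /left_derivative; lra.
by move: up => /= up; rewrite ler_norml; apply/andP; split; lra.
Qed.

Lemma right_increment_approx F f c e a b : a <= b -> {homo F : x y / x < y} ->
  (forall x, F y @[y --> x^'-] --> F x) ->
  (forall x, f y @[y --> x^'-] --> f x) ->
  right_derivable F f ->
  (forall x, a <= x -> x < b -> `|right_derivative F f x - c| < e) ->
  `|f b - f a - c * (F b - F a)| <= e * (F b - F a).
Proof.
move=> ab Finc Fr fr df H.
have lo : f b - f a <= (c + e) * (F b - F a).
  apply: right_quotient_le => // x ax xb.
  apply: (cvgr_lt _ (df x)); have := H _ ax xb.
  by rewrite ltr_norml => /andP[_]; rewrite ltrBlDr addrC.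
have up : (\- f) b - (\- f) a <= (- c + e) * (F b - F a).
  apply: right_quotient_le => // [x|x ax xb]; first exact: cvgN.
  under eq_near do rewrite diff_quotientN ltrNl.
  apply: (cvgr_gt _ (df x)); have := H _ ax xb.
  rewrite ltr_norml => /andP[+ _]; rewrite /right_derivative; lra.
by move: up => /= up; rewrite ler_norml; apply/andP; split; lra.
Qed.

End intervals.

(** * Cadlag functions: small oscillation on pieces, finite nets, boundedness, measurability *)

Section cadlag_functions.
Context {R : realType}.
Implicit Types (x y z a b e : R) (f g F : R -> R).

Lemma cadlagDM f g t : cadlag f -> cadlag g -> cadlag (fun x => f x + t * g x).
Proof.
move=> cf cg x; have [fr /cvg_ex[fl flx]] := cf x.
have [gr /cvg_ex[gl glx]] := cg x; split; first by apply: cvgD => //; exact: cvgMr.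
by apply/cvg_ex; exists (fl + t * gl); apply: cvgD => //; exact: cvgMr.
Qed.

Lemma cagladDM f g t : caglad f -> caglad g -> caglad (fun x => f x + t * g x).
Proof.
move=> cf cg x; have [fr /cvg_ex[fl flx]] := cf x.
have [gr /cvg_ex[gl glx]] := cg x; split; first by apply: cvgD => //; exact: cvgMr.
by apply/cvg_ex; exists (fl + t * gl); apply: cvgD => //; exact: cvgMr.
Qed.

Lemma cadlagM f g : cadlag f -> cadlag g -> cadlag (fun x => f x * g x).
Proof.
move=> cf cg x; have [fr /cvg_ex[fl flx]] := cf x.
have [gr /cvg_ex[gl glx]] := cg x; split; first by apply: cvgM.
by apply/cvg_ex; exists (fl * gl); apply: cvgM.
Qed.

(** Just left of a point, [F] is within [e / 2] of its left limit, hence within [e] of any other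
    value there; just right of it, within [e] of its value. A jump at [y] is harmless because the
    oscillation is measured on [x, y[. *)
Lemma cadlag_induction F e (P : R -> R -> Prop) a b :
  cadlag F -> 0 < e -> a < b ->
  (forall x y z, a <= x -> x < y -> y < z -> z <= b ->
    P x y -> P y z -> P x z) ->
  (forall x y, a <= x -> x < y -> y <= b ->
    (forall z, x <= z -> z < y -> `|F z - F x| < e) -> P x y) ->
  P a b.
Proof.
(* Points near [x] may leave [a, b]; [Q] holds vacuously there. *)
move=> cF e0 ab Padd Ploc; pose Q x y := a <= x -> y <= b -> P x y.
suff : Q a b by apply.
have e20 : 0 < e / 2 by lra.
apply: interval_induction => // [x y z ax xy yz zb Pxy Pyz _ _|x ax xb|x ax xb].
- by apply: (Padd _ y) => //; [apply: Pxy|apply: Pyz]; lra.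
- have [_ /cvg_ex[l Fl]] := cF x.
  near=> y => ay _; apply: Ploc => //.
  have H : forall z, y <= z -> z < x -> `|l - F z| < e / 2.
    near: y; apply: near_left_itv; move/cvgrPdist_lt : Fl; exact.
  have yx : y < x by near: y; exact: nbhs_left_lt.
  move=> z yz zx; have := H _ yz zx; have := H _ (lexx y) yx.
  by rewrite !ltr_norml => /andP[? ?] /andP[? ?]; apply/andP; split; lra.
- have [Fl _] := cF x.
  near=> y => _ yb; apply: Ploc => //.
  have H : forall z, x < z -> z <= y -> `|F x - F z| < e.
    near: y; apply: near_right_itv; move/cvgrPdist_lt : Fl; exact.
  move=> z; rewrite le_eqVlt => /predU1P[<- _|xz zy]; first by rewrite subrr normr0.
  by rewrite distrC H// ltW.
Unshelve. all: by end_near. Qed.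

(** A piece of small oscillation has its left endpoint as a net, and nets of adjacent pieces are
    concatenated. *)
Lemma cadlag_net F e a b : cadlag F -> 0 < e -> a < b ->
  exists s : seq R, (forall y, y \in s -> a <= y /\ y < b) /\
    forall x, a <= x -> x < b -> exists2 y, y \in s & `|F x - F y| < e.
Proof.
move=> cF e0 ab.
pose P u v := exists s : seq R, (forall y, y \in s -> u <= y /\ y < v) /\
    forall x, u <= x -> x < v -> exists2 y, y \in s & `|F x - F y| < e.
apply: (@cadlag_induction F e P) => // [x y z ax xy yz zb [s [si sP]] [t [ti tP]]|].
  exists (s ++ t); split=> [w|w xw wz].
    by rewrite mem_cat => /orP[/si|/ti] [? ?]; split; lra.
  have [wy|yw] := ltP w y.
    by have [v vs vP] := sP _ xw wy; exists v; rewrite // mem_cat vs.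
  by have [v vs vP] := tP _ yw wz; exists v; rewrite // mem_cat vs orbT.
move=> x y ax xy yb H; exists [:: x]; split=> [w|w xw wy].
  by rewrite inE => /eqP->.
by exists x; rewrite ?inE//; exact: H.
Qed.

Lemma cadlag_bounded F a b : cadlag F ->
  exists2 M, 0 <= M & forall x, a <= x -> x < b -> `|F x| <= M.
Proof.
move=> cF; have [ab|ba] := ltP a b; last first.
  by exists 0 => // x ax xb; lra.
have [s [_ sP]] := cadlag_net cF ltr01 ab.
exists (1 + \sum_(y <- s) `|F y|) => [|x ax xb].
  by rewrite addr_ge0// sumr_ge0.
have [y ys Fxy] := sP _ ax xb.
have : `|F y| <= \sum_(y <- s) `|F y|.
  by rewrite (big_rem y)//= lerDl sumr_ge0.
by have := ler_normD (F x - F y) (F y); rewrite subrK; lra.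
Qed.

(** [F] is a pointwise limit of measurable functions [G n], glued from constants and within
    [1 / (n + 1)] of [F] on [-(n + 1), n + 1[. *)
Lemma cadlag_measurable F : cadlag F ->
  measurable_fun [set: measurableTypeR R] (F : measurableTypeR R -> R).
Proof.
move=> cF.
pose P e u v := exists G : measurableTypeR R -> R,
  measurable_fun [set: measurableTypeR R] G /\
  forall x, u <= x -> x < v -> `|F x - G x| < e.
have PP (n : nat) : P n.+1%:R^-1 (- n.+1%:R) n.+1%:R.
  apply: (@cadlag_induction F n.+1%:R^-1) => //.
  - have : (0 : R) < n.+1%:R by []. lra.
  - move=> x y z ax xy yz zb [G [mG GP]] [H [mH HP]].
    exists (fun w => if w < y then G w else H w); split=> [|w xw wz].
      apply: measurable_fun_ifT => //.
      by apply: measurable_fun_ltr.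
    by case: ifPn => [wy|]; [exact: GP|rewrite -leNgt => yw; exact: HP].
  - move=> x y ax xy yb H; exists (cst (F x)); split => //.
have /choice[G GP] := PP.
apply: (@measurable_fun_cvg _ _ _ _ G) => [n|x _]; first by have [] := GP n.
apply/cvgrPdist_lt => e e0; near=> n.
have [_ H] := GP n.
have xn : `|x| < n.+1%:R.
  near: n; have := nbhs_infty_gtr `|x|; apply: filterS => n /lt_trans; apply.
  by rewrite ltr_nat.
apply: lt_trans (H x _ _) _.
- by move: xn; rewrite ltr_norml => /andP[/ltW].
- by move: xn; rewrite ltr_norml => /andP[].
- near: n; exact: near_infty_natSinv_lt (PosNum e0).
Unshelve. all: by end_near. Qed.

End cadlag_functions.

(** * Integrals of cadlag functions against dV *)

Section torus_measure.
Context {R : realType} (V : R -> R).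
Hypotheses (iV : integrator V) (lV : caglad V).
Local Notation mu := (dV iV lV : {measure set (measurableTypeR R) -> \bar R}).
Local Notation mR := (measurableTypeR R).
Implicit Types (F : R -> R).

#[global] Instance dV_ae_filter : Filter (almost_everywhere mu) :=
  ae_filter_ringOfSetsType mu.

Lemma dV_ae : \forall x \ae mu, (0 : R) <= x < 1.
Proof.
exists (~` `[0, 1[); split.
- by apply: measurableC; exact: measurable_itv.
- by rewrite [LHS]/= /dV setICl preimage_set0 measure0.
- by move=> x /=; rewrite in_itv.
Qed.

Lemma dV_setT : mu setT = (V 1)%:E.
Proof.
transitivity (mu `[0, 1[%classic); first by rewrite /= /dV setTI setIid.
by rewrite /= dVE// (integrator0 iV) subr0.
Qed.

Lemma integrator1_gt0 : 0 < V 1.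
Proof. by rewrite -(integrator0 iV); apply: (integrator_increasing iV). Qed.

Lemma cadlag_integrable F a b : cadlag F -> 
  mu.-integrable (`[a, b[ : set mR) (EFin \o F).
Proof.
move=> cF; apply: measurable_bounded_integrable.
- exact: measurable_itv.
- apply: le_lt_trans (_ : mu setT < +oo)%E; last by rewrite dV_setT ltry.
  by apply: le_measure; rewrite ?inE//; exact: measurable_itv.
- by apply: measurable_funTS; exact: cadlag_measurable.
- have [M M0 FM] := cadlag_bounded a b cF.
  exists M; split; first exact: num_real.
  move=> y My x /=; rewrite in_itv/= => /andP[ax xb].
  by apply: le_trans (ltW My); exact: FM.
Qed.

(** The complement of [0, 1[ is a null set. The norm is an integral over R, whereas additivity and
    local estimates concern intervals. *)
Lemma cadlag_RintegralT F : cadlag F ->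
  (\int[mu]_x F x = \int[mu]_(x in `[0, 1[ : set mR) F x)%R.
Proof.
move=> cF; have mF := cadlag_measurable cF.
rewrite /Rintegral [in RHS]integral_mkcond; congr fine.
apply: ae_eq_integral => //.
- exact/measurable_EFinP.
- apply/(measurable_restrictT _ _).1; first exact: measurable_itv.
  by apply: measurable_funTS; exact/measurable_EFinP.
- apply: filterS dV_ae => x x01 _ /=.
  by rewrite patchE mem_set//= in_itv.
Qed.

Lemma Rintegral_itv_split F x y z : cadlag F -> x < y -> y < z ->
  (\int[mu]_(t in `[x, z[ : set mR) F t =
   \int[mu]_(t in `[x, y[ : set mR) F t + \int[mu]_(t in `[y, z[ : set mR) F t)%R.
Proof.
move=> cF xy yz.
have xzE : `[x, z[%classic = (`[x, y[ `|` `[y, z[ : set mR).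
  apply/seteqP; split=> t /=; rewrite !in_itv /=.
    move=> /andP[xt tz]; have [ty|yt] := ltP t y; [left|right].
      by rewrite xt.
    by rewrite tz.
  by move=> [|] /andP[? ?]; apply/andP; split; lra.
rewrite xzE Rintegral_setU//.
- by rewrite -xzE; exact: cadlag_integrable.
- apply/disj_setPS => t /=; rewrite !in_itv /= => -[/andP[? ?] /andP[? ?]]; lra.
Qed.

(** The integrand lies between the constants [c - K] and [c + K], and [a, b[ has measure exactly
    [V b - V a]: an atom at [b] is left to the next interval. *)
Lemma Rintegral_itv_approx F a b c K : cadlag F -> 0 <= a -> a <= b -> b <= 1 ->
  (forall z, a <= z -> z < b -> `|F z - c| <= K) ->
  `| \int[mu]_(t in `[a, b[ : set mR) F t - c * (V b - V a) |%R
     <= K * (V b - V a).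
Proof.
move=> cF a0 ab b1 H.
have cst_int k : (\int[mu]_(t in `[a, b[ : set mR) cst k t = k * (V b - V a))%R.
  rewrite Rintegral_cst; last exact: measurable_itv.
  by rewrite /= dVE.
have icst k : mu.-integrable (`[a, b[ : set mR) (EFin \o cst k).
  apply: cadlag_integrable => x; split; first exact: cvg_cst.
  by apply/cvg_ex; exists k; exact: cvg_cst.
have iF := cadlag_integrable a b cF.
rewrite ler_norml; apply/andP; split.
  rewrite lerBrDl -mulrBl -cst_int; apply: le_Rintegral => //.
  move=> x /=; rewrite in_itv/= => /andP[ax xb].
  by have := H _ ax xb; rewrite ler_norml => /andP[? ?]; lra.
rewrite lerBlDl -mulrDl -cst_int; apply: le_Rintegral => //.
move=> x /=; rewrite in_itv/= => /andP[ax xb].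
by have := H _ ax xb; rewrite ler_norml => /andP[? ?]; lra.
Qed.

End torus_measure.

(** * The Dirichlet integral bounds squared increments *)

Section energy.
Context {R : realType}.

(** The Cauchy-Schwarz inequality in Engel's form; the two sides differ by an explicit square over a
    positive number. *)
Lemma sqr_div_subadditive (p q s t : R) : 0 < s -> 0 < t ->
  (p + q) ^+ 2 / (s + t) <= p ^+ 2 / s + q ^+ 2 / t.
Proof.
move=> s0 t0; have st0 : 0 < s + t by lra.
rewrite -subr_ge0.
have -> : p ^+ 2 / s + q ^+ 2 / t - (p + q) ^+ 2 / (s + t) =
  (p * t - q * s) ^+ 2 / (s * t * (s + t)).
  by field; rewrite !gt_eqF.
by rewrite divr_ge0 ?sqr_ge0// !mulr_ge0 ?ltW.
Qed.

Lemma product_close (u v c d e : R) : 0 < e -> e <= 1 ->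
  `|u - c| < e -> `|v - d| < e -> `|u * v - c * d| <= e * (`|c| + `|d| + 1).
Proof.
move=> e0 e1 uc vd.
have -> : u * v - c * d = (u - c) * (v - d) + (u - c) * d + c * (v - d) by ring.
rewrite (le_trans (ler_normD _ _))// (le_trans (lerD (ler_normD _ _) (lexx _)))//.
rewrite !normrM.
have : `|u - c| * `|v - d| <= e * 1 by rewrite ler_pM// ltW// (lt_le_trans vd).
have : `|u - c| * `|d| <= e * `|d| by rewrite ler_wpM2r// ltW.
have : `|c| * `|v - d| <= `|c| * e by rewrite ler_wpM2l// ltW.
lra.
Qed.

(** [D] and [w] stand for increments of f and W, [g] for the derivative at the right endpoint. The
    left side is [D * (D - g * w) / w], where [D] is of order [w] and the other factor of order
    [e * w]. *)
Lemma quotient_step (D w g c e : R) : 0 < w -> 0 < e -> e <= 1 ->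
  `|g - c| < e -> `|D - c * w| <= e * w ->
  D ^+ 2 / w - g * D <= 2 * e * (`|c| + 1) * w.
Proof.
move=> w0 e0 e1 gc Dc.
have -> : D ^+ 2 / w - g * D = D * (D - g * w) / w by field; rewrite gt_eqF.
rewrite ler_pdivrMr//; apply: le_trans (ler_norm _) _; rewrite normrM.
have H1 : `|D| <= (`|c| + 1) * w.
  have := ler_normD (D - c * w) (c * w); rewrite subrK normrM (gtr0_norm w0).
  have : e * w <= 1 * w by rewrite ler_pM2r.
  lra.
have H2 : `|D - g * w| <= 2 * e * w.
  have -> : D - g * w = (D - c * w) - (g - c) * w by ring.
  have := ler_normB (D - c * w) ((g - c) * w).
  rewrite [`|(g - c) * w|]normrM (gtr0_norm w0).
  have : `|g - c| * w <= e * w by rewrite ler_pM2r// ltW.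
  lra.
have := ler_pM (normr_ge0 _) (normr_ge0 _) H1 H2.
by rewrite (_ : (`|c| + 1) * w * (2 * e * w) = 2 * e * (`|c| + 1) * w * w)//; ring.
Qed.

(** [I] stands for the integral of f h, [u] for f at the left endpoint, [G] and [v] for increments
    of g and V. Both [I] and [u * G] are close to [c * d * v]. *)
Lemma integral_step (I u G v c d e : R) : 0 <= v -> 0 < e -> e <= 1 ->
  `|u - c| < e -> `|G - d * v| <= e * v ->
  `|I - c * d * v| <= e * (`|c| + `|d| + 1) * v ->
  I - u * G <= 2 * e * (`|c| + `|d| + 1) * v.
Proof.
move=> v0 e0 e1 uc Gd Ic.
have -> : I - u * G = (I - c * d * v) - u * (G - d * v) - (u - c) * d * v by ring.
have u1 : `|u| <= `|c| + 1.
  by have := ler_normD (u - c) c; rewrite subrK; lra.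
have H1 : `|u * (G - d * v)| <= (`|c| + 1) * (e * v).
  by rewrite normrM ler_pM.
have H2 : `|(u - c) * d * v| <= e * `|d| * v.
  by rewrite !normrM (ger0_norm v0) !ler_wpM2r// ltW.
move: Ic H1 H2; rewrite !ler_norml => /andP[_ ?] /andP[? _] /andP[? _]; lra.
Qed.

Context (W V : R -> R).
Hypotheses (iW : integrator W) (rW : cadlag W) (iV : integrator V) (lV : caglad V).
Local Notation mR := (measurableTypeR R).
Local Notation mu := (dV iV lV : {measure set mR -> \bar R}).
Local Notation DW := (left_derivative W).
Local Notation DV := (right_derivative V).

(** For smooth [f], the square of the norm of [DW f] in the L^2 space of dW, after an integration by
    parts. *)
Definition dirichlet (f : R -> R) : R :=
  (- \int[mu]_(t in `[0%R, 1%R[ : set mR) (f t * DV (DW f) t))%R.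

Variable f : R -> R.
Hypothesis sf : smooth W V f.
Let g := DW f.
Let h := DV g.
Let I a b := (\int[mu]_(t in `[a, b[ : set mR) (f t * h t))%R.
(* The right-hand side, g b * (f b - f a) + f a * (g b - g a) - I a b, is additive
   in (a, b) and the left-hand side is subadditive.  When f, h vary little on
   [a, b[ and g on ]a, b], so that g b is close to (f b - f a) / (W b - W a) and
   g b - g a to h a * (V b - V a), the inequality follows. *)
Let P k a b := (f b - f a) ^+ 2 / (W b - W a)
  - k * (W b - W a) - k * (V b - V a) <= g b * f b - g a * f a - I a b.

Let cfh : cadlag (fun t => f t * h t).
Proof.
by apply: cadlagM; [exact: smooth_cadlag sf|exact: smooth_right_derivative sf].
Qed.

(** The mean value inequalities give [A] for f against W and [B] for g against V, and [C] compares
    the integral with a constant; the two algebraic steps turn these into the two error terms of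
    [P]. *)
Let energy_step a b cf cg ch e : 0 <= a -> a < b -> b <= 1 -> 0 < e -> e <= 1 ->
  (forall z, a < z -> z <= b -> `|g z - cg| < e) ->
  (forall z, a <= z -> z < b -> `|f z - cf| < e) ->
  (forall z, a <= z -> z < b -> `|h z - ch| < e) ->
  P (2 * e * (`|cf| + `|cg| + `|ch| + 1)) a b.
Proof.
move=> a0 ab b1 e0 e1 Hg Hf Hh.
have w0 : 0 < W b - W a by rewrite subr_gt0; apply: (integrator_increasing iW).
have v0 : 0 <= V b - V a.
  by rewrite subr_ge0 ltW//; apply: (integrator_increasing iV).
have A : `|f b - f a - cg * (W b - W a)| <= e * (W b - W a).
  apply: left_increment_approx => //; first exact: ltW.
  - exact: integrator_increasing iW.
  - by move=> x; have [] := rW x.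
  - by move=> x; have [] := smooth_cadlag sf x.
  - exact: smooth_left_derivable sf.
have B : `|g b - g a - ch * (V b - V a)| <= e * (V b - V a).
  apply: right_increment_approx => //; first exact: ltW.
  - exact: integrator_increasing iV.
  - by move=> x; have [] := lV x.
  - by move=> x; exact: (smooth_left_derivative sf x).1.
  - exact: smooth_right_derivable sf.
have C : `|I a b - cf * ch * (V b - V a)| <= e * (`|cf| + `|ch| + 1) * (V b - V a).
  apply: Rintegral_itv_approx => //; first exact: ltW.
  by move=> z az zb; apply: product_close => //; [exact: Hf|exact: Hh].
have Q1 := quotient_step w0 e0 e1 (Hg _ ab (lexx b)) A.
have Q2 := integral_step v0 e0 e1 (Hf _ (lexx a) ab) B C.
(* [Q1] and [Q2] have different constants; these two terms enlarge both to the one in [P]. *)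
have cg0 : 0 <= e * `|cg| * (V b - V a) by rewrite !mulr_ge0// ltW.
have cc0 : 0 <= e * (`|cf| + `|ch|) * (W b - W a).
  by rewrite !mulr_ge0 ?(addr_ge0 (normr_ge0 _) (normr_ge0 _)) ?ltW.
rewrite /P; lra.
Qed.

Let e_of k c : 0 < k -> 0 <= c ->
  exists e : R, [/\ 0 < e, e <= 1 & 2 * e * (c + 1) <= k].
Proof.
move=> k0 c0; exists (Num.min 1 (k / (2 * (c + 1)))).
have c1 : 0 < 2 * (c + 1) by lra.
split; first by rewrite lt_min ltr01 divr_gt0.
  by rewrite ge_min lexx.
set e := Num.min _ _; have : e <= k / (2 * (c + 1)) by rewrite /e ge_min lexx orbT.
by rewrite ler_pdivlMr//; lra.
Qed.

Let P_weaken k k' a b : 0 <= a -> a < b -> k <= k' -> P k a b -> P k' a b.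
Proof.
move=> a0 ab kk; rewrite /P; apply: le_trans.
have w0 : W a < W b by apply: (integrator_increasing iW).
have v0 : V a < V b by apply: (integrator_increasing iV).
have : k * (W b - W a) <= k' * (W b - W a) by rewrite ler_wpM2r// subr_ge0 ltW.
have : k * (V b - V a) <= k' * (V b - V a) by rewrite ler_wpM2r// subr_ge0 ltW.
lra.
Qed.

(** The errors are additive over adjacent intervals, so the same [k] survives every subdivision;
    near a point, [e] is taken small in terms of [k] and of the one-sided limits there. *)
Let P_itv k a b : 0 < k -> 0 <= a -> a < b -> b <= 1 -> P k a b.
Proof.
move=> k0 a0 ab b1; apply: (@interval_induction _ (P k) a b) => //.
- move=> x y z ax xy yz zb.
  have := integrator_increasing iW xy; have := integrator_increasing iW yz => ? ?.
  have IE : I x z = I x y + I y z by exact: Rintegral_itv_split.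
  rewrite /P IE.
  have := @sqr_div_subadditive (f z - f y) (f y - f x) (W z - W y) (W y - W x).
  have -> : f z - f y + (f y - f x) = f z - f x by ring.
  have -> : W z - W y + (W y - W x) = W z - W x by ring.
  move=> /(_ ltac:(lra) ltac:(lra)); lra.
(* On the left of [x], f and h are close to their left limits, and g to [g x]. *)
- move=> x ax xb.
  have [fr /cvg_ex[cf fl]] := smooth_cadlag sf x.
  have [hr /cvg_ex[ch hl]] := smooth_right_derivative sf x.
  have [gl _] := smooth_left_derivative sf x.
  have c0 : 0 <= `|cf| + `|g x| + `|ch| by rewrite !addr_ge0.
  have [e [e0 e1 ek]] := e_of k0 c0.
  near=> y; have yx : y < x by [].
  have ay : a <= y by near: y; exact: nbhs_left_ge.
  apply: (P_weaken _ _ ek) => //; first lra.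
  apply: energy_step => //; [lra|lra| | |].
  + move=> z yz; rewrite le_eqVlt => /predU1P[->|zx]; first by rewrite subrr normr0.
    rewrite distrC.
    suff : forall z, y < z -> z < x -> `|g x - g z| < e by apply.
    move=> {z yz zx} z /ltW; move: z; near: y.
    by apply: near_left_itv; move/cvgrPdist_lt : gl; exact.
  + move=> z yz zx; rewrite distrC; move: z yz zx; near: y.
    by apply: near_left_itv; move/cvgrPdist_lt : fl; exact.
  + move=> z yz zx; rewrite distrC; move: z yz zx; near: y.
    by apply: near_left_itv; move/cvgrPdist_lt : hl; exact.
(* On the right of [x], f and h are close to their values at [x], and g to its right limit. *)
- move=> x ax xb.
  have [fr _] := smooth_cadlag sf x.
  have [hr _] := smooth_right_derivative sf x.
  have [_ /cvg_ex[cg gr]] := smooth_left_derivative sf x.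
  have c0 : 0 <= `|f x| + `|cg| + `|h x| by rewrite !addr_ge0.
  have [e [e0 e1 ek]] := e_of k0 c0.
  near=> y; have xy : x < y by [].
  have yb : y <= b by near: y; exact: nbhs_right_le.
  apply: (P_weaken _ _ ek) => //; first lra.
  apply: energy_step => //; [lra|lra| | |].
  + move=> z xz zy; rewrite distrC; move: z xz zy; near: y.
    by apply: near_right_itv; move/cvgrPdist_lt : gr; exact.
  + move=> z; rewrite le_eqVlt => /predU1P[<- _|xz /ltW].
      by rewrite subrr normr0.
    rewrite distrC; move: z xz; near: y.
    by apply: near_right_itv; move/cvgrPdist_lt : fr; exact.
  + move=> z; rewrite le_eqVlt => /predU1P[<- _|xz /ltW].
      by rewrite subrr normr0.
    rewrite distrC; move: z xz; near: y.
    by apply: near_right_itv; move/cvgrPdist_lt : hr; exact.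
Unshelve. all: by end_near. Qed.

Let P_refl k a : P k a a.
Proof.
rewrite /P /I set_itvco0 ?Rintegral_set0 ?lexx// !subrr !expr0n/=.
by rewrite !mul0r !mulr0 !subr0.
Qed.

Let P_itv_le k a b : 0 < k -> 0 <= a -> a <= b -> b <= 1 -> P k a b.
Proof.
by move=> k0 a0; rewrite le_eqVlt => /predU1P[->//|ab]; exact: P_itv.
Qed.

(** The increments of [W] and [f] are 1-periodic, so the difference quotients at 0 and 1 coincide.
    The boundary terms of the summation by parts thus cancel on the torus. *)
Lemma smooth_boundary : g 1 * f 1 = g 0 * f 0.
Proof.
have fp x : f (x + 1) = f x by exact: (smooth_periodic sf).
have f1 : f 1 = f 0 by rewrite -(fp 0) add0r.
rewrite f1; congr (_ * _).
rewrite /g /left_derivative.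
suff -> : diff_quotient W f 1 = diff_quotient W f 0 by [].
apply/funext => t; rewrite /diff_quotient add0r (addrC 1) fp f1.
congr (_ / _).
by have := integrator_increment iW t; rewrite (integrator0 iW); lra.
Qed.

(** [P] is summed over [0, x], [x, y] and [y, 1]: the products of g and f telescope to zero, and the
    squares from the outer intervals are dropped. *)
Lemma dirichlet_ge_increment x y : 0 <= x -> x < y -> y <= 1 ->
  (f y - f x) ^+ 2 / (W y - W x) <= dirichlet f.
Proof.
move=> x0 xy y1; apply/ler_addgt0Pr => e e0.
have W1 : 0 < W 1 by exact: integrator1_gt0.
have V1 : 0 < V 1 by exact: integrator1_gt0.
(* The errors of the three intervals add up to [k * (W 1 + V 1)], which is [e]. *)
pose k := e / (W 1 + V 1).
have k0 : 0 < k by rewrite divr_gt0// addr_gt0.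
have kE : k * (W 1 + V 1) = e by rewrite /k divfK// gt_eqF// addr_gt0.
have IE : I 0 1 = I 0 x + I x y + I y 1.
  have I00 a : I a a = 0 by rewrite /I set_itvco0 ?Rintegral_set0.
  rewrite (_ : I 0 1 = I 0 y + I y 1); last first.
    move: y1; rewrite le_eqVlt => /predU1P[->|y1]; first by rewrite I00 addr0.
    by apply: Rintegral_itv_split => //; lra.
  congr (_ + _); move: x0; rewrite le_eqVlt => /predU1P[<-|x0].
    by rewrite I00 add0r.
  exact: Rintegral_itv_split.
have P1 := P_itv_le k0 (lexx 0) x0 (le_trans (ltW xy) y1).
have P2 := P_itv_le k0 x0 (ltW xy) y1.
have P3 := P_itv_le k0 (le_trans x0 (ltW xy)) y1 (lexx 1).
have sq a b : a <= b -> 0 <= (f b - f a) ^+ 2 / (W b - W a).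
  rewrite le_eqVlt => /predU1P[->|ab]; first by rewrite subrr expr0n/= mul0r.
  by rewrite divr_ge0 ?sqr_ge0// subr_ge0 ltW//; apply: (integrator_increasing iW).
have := sq _ _ x0; have := sq _ _ y1.
move: P1 P2 P3; rewrite /P /dirichlet -/g -/h -/(I 0 1) IE.
have := smooth_boundary; rewrite (integrator0 iW) (integrator0 iV).
move: (_ / (W x - 0)) (_ / (W y - W x)) (_ / (W 1 - W y)) => q1 q2 q3.
move: (I 0 x) (I x y) (I y 1) (g 0 * f 0) (g x * f x) (g y * f y) (g 1 * f 1).
move: kE; clear; move: (W x) (W y) (W 1) (V x) (V y) (V 1) => ? ? ? ? ? ? kE.
by move=> I1 I2 I3 g0 gx gy g1 *; lra.
Qed.

Lemma dirichlet_ge0 : 0 <= dirichlet f.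
Proof.
apply: le_trans (dirichlet_ge_increment (lexx 0) ltr01 (lexx 1)).
by rewrite divr_ge0 ?sqr_ge0// subr_ge0 ltW//; apply: (integrator_increasing iW).
Qed.

End energy.

(** * Linearity, the energetic seminorm on smooth functions, and its extension *)

Section linear_structure.
Context {R : realType}.

Lemma nonneg_quadratic_discriminant (a b c : R) : 0 <= c ->
  (forall t, 0 <= a + t * b + t ^+ 2 * c) -> b ^+ 2 <= 4 * a * c.
Proof.
rewrite le_eqVlt => /predU1P[<- H|c0 H].
  have [->|b0] := eqVneq b 0; first by rewrite expr0n mulr0.
  (* For [c = 0] the polynomial is affine and equals -1 at this point. *)
  have := H (- (a + 1) / b); rewrite mulr0 addr0 divfK//; lra.
(* The minimizer of the quadratic polynomial. *)
have := H (- b / (2 * c)).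
have -> : a + - b / (2 * c) * b + (- b / (2 * c)) ^+ 2 * c
          = (4 * a * c - b ^+ 2) / (4 * c).
  by field; rewrite gt_eqF.
by rewrite pmulr_lge0 ?subr_ge0// invr_gt0; lra.
Qed.

Lemma diff_quotientDM F f g (t x h : R) :
  diff_quotient F (fun y => f y + t * g y) x h =
  diff_quotient F f x h + t * diff_quotient F g x h.
Proof. by rewrite /diff_quotient mulrA -mulrDl; congr (_ / _); ring. Qed.

Lemma left_derivableDM F f g (t : R) :
  left_derivable F f -> left_derivable F g ->
  left_derivable F (fun y => f y + t * g y) /\
  left_derivative F (fun y => f y + t * g y) =
    (fun y => left_derivative F f y + t * left_derivative F g y).
Proof.
move=> df dg.
have H x : diff_quotient F (fun y => f y + t * g y) x h @[h --> 0^'-] -->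
    left_derivative F f x + t * left_derivative F g x.
  under eq_cvg do rewrite diff_quotientDM.
  by apply: cvgD; [exact: df|apply: cvgMr; exact: dg].
split; first by move=> x; apply/cvg_ex; eexists; exact: H.
by apply/funext => x; apply: cvg_lim => //; exact: H.
Qed.

Lemma right_derivableDM F f g (t : R) :
  right_derivable F f -> right_derivable F g ->
  right_derivable F (fun y => f y + t * g y) /\
  right_derivative F (fun y => f y + t * g y) =
    (fun y => right_derivative F f y + t * right_derivative F g y).
Proof.
move=> df dg.
have H x : diff_quotient F (fun y => f y + t * g y) x h @[h --> 0^'+] -->
    right_derivative F f x + t * right_derivative F g x.
  under eq_cvg do rewrite diff_quotientDM.
  by apply: cvgD; [exact: df|apply: cvgMr; exact: dg].
split; first by move=> x; apply/cvg_ex; eexists; exact: H.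
by apply/funext => x; apply: cvg_lim => //; exact: H.
Qed.

Context (W V : R -> R).
Hypotheses (iW : integrator W) (rW : cadlag W) (iV : integrator V) (lV : caglad V).
Local Notation mR := (measurableTypeR R).
Local Notation mu := (dV iV lV : {measure set mR -> \bar R}).
Local Notation DW := (left_derivative W).
Local Notation DV := (right_derivative V).
Local Notation "f +[ t ] g" := (fun y => f y + t * g y) (at level 50).
Implicit Types (f g : R -> R) (t : R).

Lemma left_derivativeDM f g t : smooth W V f -> smooth W V g ->
  DW (f +[t] g) = DW f +[t] DW g.
Proof.
by move=> sf sg; have [] := left_derivableDM t (smooth_left_derivable sf) (smooth_left_derivable sg).
Qed.

Lemma right_derivativeDM f g t : smooth W V f -> smooth W V g ->
  DV (DW (f +[t] g)) = DV (DW f) +[t] DV (DW g).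
Proof.
move=> sf sg; rewrite left_derivativeDM//.
by case: (right_derivableDM t (smooth_right_derivable sf) (smooth_right_derivable sg)).
Qed.

Lemma smoothDM f g t : smooth W V f -> smooth W V g -> smooth W V (f +[t] g).
Proof.
move=> sf sg; split.
- by move=> x /=; rewrite (smooth_periodic sf) (smooth_periodic sg).
- by apply: cadlagDM; [exact: smooth_cadlag sf|exact: smooth_cadlag sg].
- by case: (left_derivableDM t (smooth_left_derivable sf) (smooth_left_derivable sg)).
- rewrite left_derivativeDM//.
  exact: cagladDM (smooth_left_derivative sf) (smooth_left_derivative sg).
- rewrite left_derivativeDM//.
  by case: (right_derivableDM t (smooth_right_derivable sf) (smooth_right_derivable sg)).
- rewrite right_derivativeDM//.
  exact: cadlagDM (smooth_right_derivative sf) (smooth_right_derivative sg).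
Qed.

Definition energy_form f g : R :=
  (\int[mu]_(x in `[0%R, 1%R[ : set mR) ((f x - DV (DW f) x) * g x))%R.

Lemma energy_integrand_cadlag f g : smooth W V f -> smooth W V g ->
  cadlag (fun x => (f x - DV (DW f) x) * g x).
Proof.
move=> sf sg; apply: cadlagM; last exact: smooth_cadlag sg.
under eq_fun do rewrite -mulN1r.
by apply: cadlagDM; [exact: smooth_cadlag sf|exact: smooth_right_derivative sf].
Qed.

Lemma smooth_normE f : smooth W V f ->
  smooth_norm W iV lV f = Num.sqrt (energy_form f f).
Proof.
move=> sf; rewrite /smooth_norm /inner_V /energy_form; congr Num.sqrt.
by rewrite -cadlag_RintegralT//; exact: energy_integrand_cadlag.
Qed.

Lemma energy_form_dirichlet f : smooth W V f ->
  energy_form f f =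
  (\int[mu]_(x in `[0%R, 1%R[ : set mR) f x ^+ 2)%R + dirichlet W iV lV f.
Proof.
move=> sf; have cf := smooth_cadlag sf.
have ch := smooth_right_derivative sf.
rewrite /dirichlet -RintegralB.
- by apply: eq_Rintegral => x _; ring.
- exact: measurable_itv.
- by apply: cadlag_integrable; under eq_fun do rewrite expr2; exact: cadlagM.
- by apply: cadlag_integrable; exact: cadlagM.
Qed.

Lemma energy_form_ge0 f : smooth W V f -> 0 <= energy_form f f.
Proof.
move=> sf; rewrite energy_form_dirichlet// addr_ge0//; last exact: dirichlet_ge0.
by apply: Rintegral_ge0 => x _; exact: sqr_ge0.
Qed.

Lemma energy_formDM f g t : smooth W V f -> smooth W V g ->
  energy_form (f +[t] g) (f +[t] g) = energy_form f f
    + t * (energy_form f g + energy_form g f) + t ^+ 2 * energy_form g g.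
Proof.
move=> sf sg; rewrite /energy_form right_derivativeDM//.
have int f' g' : smooth W V f' -> smooth W V g' ->
    mu.-integrable (`[0, 1[ : set mR)
      (EFin \o (fun x => (f' x - DV (DW f') x) * g' x)).
  by move=> sf' sg'; apply: cadlag_integrable; exact: energy_integrand_cadlag.
have m01 : measurable (`[0, 1[ : set mR) by exact: measurable_itv.
have intZ k f' : mu.-integrable (`[0, 1[ : set mR) (EFin \o f') ->
    mu.-integrable (`[0, 1[ : set mR) (EFin \o (fun x => k * f' x)).
  by move=> i; apply: (integrableZl m01 k i).
have intD f' g' : mu.-integrable (`[0, 1[ : set mR) (EFin \o f') ->
    mu.-integrable (`[0, 1[ : set mR) (EFin \o g') ->
    mu.-integrable (`[0, 1[ : set mR) (EFin \o (fun x => f' x + g' x)).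
  by move=> i j; apply: (integrableD m01 i j).
rewrite -RintegralD ?int// -!RintegralZl ?intD ?int//.
rewrite -!RintegralD ?intD ?intZ ?intD ?int//.
by apply: eq_Rintegral => x _; ring.
Qed.

(* Cauchy-Schwarz is used for the symmetrization of energy_form, which spares a
   proof that the form is symmetric. *)
Lemma smooth_norm_triangle f g : smooth W V f -> smooth W V g ->
  smooth_norm W iV lV (f +[1] g) <= smooth_norm W iV lV f + smooth_norm W iV lV g.
Proof.
move=> sf sg; rewrite !smooth_normE//; last exact: smoothDM.
have Qf := energy_form_ge0 sf; have Qg := energy_form_ge0 sg.
have := nonneg_quadratic_discriminant Qg
  (b := energy_form f g + energy_form g f) (a := energy_form f f).
have H t : 0 <= energy_form f f + t * (energy_form f g + energy_form g f) +
                t ^+ 2 * energy_form g g.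
  by rewrite -energy_formDM//; apply: energy_form_ge0; exact: smoothDM.
move=> /(_ H); set S := _ + _ => SQ.
have := energy_formDM 1 sf sg; rewrite -/S mul1r expr1n mul1r => ->.
rewrite -[leRHS]ger0_norm ?addr_ge0 ?sqrtr_ge0// -sqrtr_sqr ler_wsqrtr//.
rewrite sqrrD !sqr_sqrtr//.
suff : S <= Num.sqrt (energy_form f f) * Num.sqrt (energy_form g g) *+ 2 by lra.
rewrite (le_trans (ler_norm _))//.
rewrite -ler_sqr ?nnegrE ?mulrn_wge0 ?mulr_ge0 ?sqrtr_ge0//.
rewrite real_normK ?num_real// -mulr_natr !exprMn !sqr_sqrtr//.
by move: SQ; lra.
Qed.

Lemma smooth_norm_dist f g : smooth W V f -> smooth W V g ->
  smooth_norm W iV lV f - smooth_norm W iV lV g <= smooth_norm W iV lV (f \- g).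
Proof.
move=> sf sg; rewrite lerBlDr.
have E : f \- g = f +[-1] g by apply/funext => x /=; rewrite mulN1r.
have {1}-> : f = (f \- g) +[1] g by apply/funext => x /=; ring.
by apply: smooth_norm_triangle => //; rewrite E; exact: smoothDM.
Qed.

(** By the reverse triangle inequality, the norms of a Cauchy sequence form a Cauchy sequence of
    reals. *)
Lemma approximates_smooth_norm_cvg (f_ : nat -> R -> R) u :
  approximates W (iV := iV) (lV := lV) f_ u ->
  cvg (smooth_norm W iV lV (f_ n) @[n --> \oo]).
Proof.
move=> [sf _ cf]; apply/cauchy_cvgP/cauchy_exP => e e0.
have [[A B] /= [[M _ MA] [N _ NB]] AB] := cf _ e0.
(* The pairs of close indices contain a product of two tails, [A] and [B]; from [K] on, an index
   lies in both. *)
pose K := maxn M N; exists (smooth_norm W iV lV (f_ K)).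
exists K => //= n Kn.
have An : A n by apply: MA => /=; exact: leq_trans (leq_maxl _ _) Kn.
have Bn : B n by apply: NB => /=; exact: leq_trans (leq_maxr _ _) Kn.
have AK : A K by apply: MA; exact: leq_maxl.
have BK : B K by apply: NB; exact: leq_maxr.
have /= H1 := AB (K, n) (conj AK Bn); have /= H2 := AB (n, K) (conj An BK).
have := smooth_norm_dist (sf K) (sf n); have := smooth_norm_dist (sf n) (sf K).
by move=> H3 H4; rewrite /ball/= ltr_norml; apply/andP; split; lra.
Qed.

(** The set under [get] is nonempty, since the norms of any approximating sequence converge; the
    default value of [get] does not arise. *)
Lemma energetic_normP u : energetic_space W iV lV u ->
  exists2 f_ : nat -> R -> R, approximates W (iV := iV) (lV := lV) f_ u &
    smooth_norm W iV lV (f_ n) @[n --> \oo] --> energetic_norm W iV lV u.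
Proof.
move=> [f_ fu]; apply: (@getPex _ [set r | exists2 f_ : nat -> R -> R,
  approximates W (iV := iV) (lV := lV) f_ u &
  smooth_norm W iV lV (f_ n) @[n --> \oo] --> r]).
have /cvg_ex[r fr] := approximates_smooth_norm_cvg fu.
by exists r, f_.
Qed.

End linear_structure.

(** * Uniform bound and Hoelder estimate from an energy bound *)

Section energy_bounds.
Context {R : realType} (W V : R -> R).
Hypotheses (iW : integrator W) (rW : cadlag W) (iV : integrator V) (lV : caglad V).
Local Notation mR := (measurableTypeR R).
Local Notation mu := (dV iV lV : {measure set mR -> \bar R}).

Definition half_holder (L : R) (F : R -> R) : Prop :=
  forall x y, 0 <= x < 1 -> 0 <= y < 1 -> (F x - F y) ^+ 2 <= L * `|W x - W y|.

Definition equibounded (L C : R) (F : R -> R) : Prop :=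
  [/\ measurable_fun [set: mR] (F : mR -> R),
      forall x, 0 <= x < 1 -> `|F x| <= C & half_holder L F].

Lemma integrator_diff_le1 x y : 0 <= x < 1 -> 0 <= y < 1 -> `|W x - W y| <= W 1.
Proof.
have Wle a b : a <= b -> W a <= W b.
  by rewrite le_eqVlt => /predU1P[->//|/(integrator_increasing iW)/ltW].
move=> /andP[x0 x1] /andP[y0 y1].
have := Wle _ _ x0; have := Wle _ _ y0; have := Wle _ _ (ltW x1).
have := Wle _ _ (ltW y1); rewrite (integrator0 iW) => *.
by rewrite ler_norml; apply/andP; split; lra.
Qed.

Lemma energy_half_holder f L : smooth W V f -> energy_form W iV lV f f <= L ->
  half_holder L f.
Proof.
move=> sf fL x y; wlog xy : x y / x < y => [wlog x01 y01|/andP[x0 x1] /andP[y0 y1]].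
  have [xy|yx|->] := ltgtP x y; first exact: wlog.
    by rewrite -sqrrN opprB distrC; exact: wlog.
  by rewrite !subrr expr0n/= normr0 mulr0.
have Wxy : W x < W y by exact: (integrator_increasing iW).
have := dirichlet_ge_increment iW rW iV lV sf x0 xy (ltW y1).
rewrite ler_pdivrMr ?subr_gt0// -sqrrN opprB => /le_trans; apply.
rewrite distrC gtr0_norm ?subr_gt0// ler_wpM2r ?subr_ge0 ?(ltW Wxy)//.
apply: le_trans fL; rewrite energy_form_dirichlet// lerDr.
by apply: Rintegral_ge0 => z _; exact: sqr_ge0.
Qed.

(* f x ^+ 2 <= 2 * L * W 1 + 2 * f z ^+ 2 is integrated in z. *)
Lemma energy_bound_sup f L x : smooth W V f -> energy_form W iV lV f f <= L ->
  0 <= x < 1 -> `|f x| <= 1 + 2 * L / V 1 + 2 * L * W 1.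
Proof.
move=> sf fL x01; have V1 := integrator1_gt0 iV; have W1 := integrator1_gt0 iW.
have cf := smooth_cadlag sf.
have L0 : 0 <= L by apply: le_trans fL; exact: energy_form_ge0.
have cf2 : cadlag (fun z => f z ^+ 2).
  by under eq_fun do rewrite expr2; exact: cadlagM.
have fL2 : (\int[mu]_(z in `[0%R, 1%R[ : set mR) (f z ^+ 2) <= L)%R.
  apply: le_trans fL; rewrite energy_form_dirichlet// lerDl.
  exact: dirichlet_ge0.
have ccst k : cadlag (fun=> k : R).
  by move=> z; split; [exact: cvg_cst|apply/cvg_ex; exists k; exact: cvg_cst].
have m01 : measurable (`[0, 1[ : set mR) by exact: measurable_itv.
have : (\int[mu]_(z in `[0%R, 1%R[ : set mR) (f x ^+ 2)
     <= \int[mu]_(z in `[0%R, 1%R[ : set mR) (2 * L * W 1 + 2 * f z ^+ 2))%R.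
  apply: le_Rintegral => //; [exact: cadlag_integrable| |].
    by apply: cadlag_integrable; exact: cadlagDM.
  move=> z /=; rewrite in_itv/= => z01.
  have := energy_half_holder sf fL x01 z01.
  have := ler_wpM2l L0 (integrator_diff_le1 x01 z01).
  (* This square is [2 * (f x - f z) ^+ 2 + 2 * f z ^+ 2 - f x ^+ 2]. *)
  have := sqr_ge0 (f x - 2 * f z); nra.
have muI : fine (mu `[0, 1[%classic) = V 1.
  by rewrite /= dVE//= (integrator0 iV) subr0.
have i2 : mu.-integrable (`[0, 1[ : set mR) (EFin \o (fun z => f z ^+ 2)).
  exact: cadlag_integrable.
have i1 : mu.-integrable (`[0, 1[ : set mR) (EFin \o (fun=> 2 * L * W 1)).
  exact: cadlag_integrable.
have i3 : mu.-integrable (`[0, 1[ : set mR) (EFin \o (fun z => 2 * f z ^+ 2)).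
  exact: (integrableZl m01 2 i2).
rewrite RintegralD// RintegralZl//.
rewrite !Rintegral_cst// [X in _ * X <= _ * X + _]muI => H.
have H2 : f x ^+ 2 * V 1 <= (2 * L / V 1 + 2 * L * W 1) * V 1.
  rewrite mulrDl divfK ?gt_eqF//; lra.
rewrite ler_pM2r// in H2.
(* The two squares bound the absolute value of [f x] by [1 + f x ^+ 2], whence the summand 1 in the
   bound. *)
have := sqr_ge0 (f x - 1); have := sqr_ge0 (f x + 1) => *.
rewrite ler_norml; apply/andP; split; nra.
Qed.

Lemma energy_equibounded f L : smooth W V f -> energy_form W iV lV f f <= L ->
  equibounded L (1 + 2 * L / V 1 + 2 * L * W 1) f.
Proof.
move=> sf fL; split.
- exact: cadlag_measurable (smooth_cadlag sf).
- by move=> x; exact: energy_bound_sup.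
- exact: energy_half_holder.
Qed.

(** The net is one for [W] and so serves all [F] and [G] at once. The three errors are those of
    moving [F] from [x] to [y], exchanging [F] for [G] at [y], and moving [G] back. *)
Lemma half_holder_net L e : 0 <= L -> 0 < e ->
  exists s : seq R, (forall y, y \in s -> 0 <= y < 1) /\
    forall F G, half_holder L F -> half_holder L G ->
      (forall y, y \in s -> `|F y - G y| < e) ->
      forall x, 0 <= x < 1 -> `|F x - G x| <= 3 * e.
Proof.
(* Then [L * d <= e ^+ 2], also when [L] is 0. *)
move=> L0 e0; pose d := e ^+ 2 / (L + 1).
have d0 : 0 < d by rewrite divr_gt0 ?exprn_gt0//; lra.
have [s [si sP]] := cadlag_net rW d0 ltr01.
exists s; split=> [y /si[-> ->]//|F G FL GL FG x x01].
have [y ys Wxy] : exists2 y, y \in s & `|W x - W y| < d.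
  by case/andP: x01 => x0 x1; exact: sP.
have y01 : 0 <= y < 1 by have [-> ->] := si _ ys.
have small t : t ^+ 2 <= L * `|W x - W y| -> `|t| <= e.
  move=> tL; rewrite -ler_sqr ?nnegrE ?(ltW e0)// real_normK ?num_real//.
  apply: (le_trans tL); apply: (@le_trans _ _ (L * d)).
    by rewrite ler_wpM2l// ltW.
  rewrite /d mulrA ler_pdivrMr; last lra.
  have := sqr_ge0 e; nra.
have := small _ (FL _ _ x01 y01); have := small _ (GL _ _ x01 y01); have := FG _ ys.
rewrite ltr_norml !ler_norml => /andP[? ?] /andP[? ?] /andP[? ?].
by apply/andP; split; lra.
Qed.

End energy_bounds.

(** * An Arzela-Ascoli argument along ultrafilters *)

Section compactness.
Context {R : realType}.

Lemma ultrafilter_bounded_cvg (T : Type) (G : set_system T) (r : T -> R) C :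
  UltraFilter G -> (\forall u \near G, `|r u| <= C) ->
  exists p : R, r u @[u --> G] --> p.
Proof.
move=> GU rC.
have [|p [_ clp]] := @segment_compact R (- C) C (r @ G) _.
  by apply: filterS rC => u; rewrite /= in_itv/= -ler_norml.
exists p => A pA /=.
(* An ultrafilter converges to its cluster point: otherwise it contains the preimage of the
   complement of a neighbourhood [A], which would have to meet [A]. *)
have [//|GnA] := in_ultra_setVsetC (r @^-1` A) GU.
have [q [/= nAq Aq]] := clp (~` A) A GnA pA.
by [].
Qed.

Context (W V : R -> R).
Hypotheses (iW : integrator W) (rW : cadlag W) (iV : integrator V) (lV : caglad V).
Local Notation mR := (measurableTypeR R).
Local Notation mu := (dV iV lV : {measure set mR -> \bar R}).
Local Notation L2V := (LspaceType2 (dV iV lV)).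

Lemma Lnorm2_le (F : mR -> R) c : 0 <= c -> measurable_fun [set: mR] F ->
  (\forall x \ae mu, `|F x| <= c) ->
  ('N[dV iV lV]_2[EFin \o F] <= (c * Num.sqrt (V 1))%:E)%E.
Proof.
move=> c0 mF Fc.
have V1 : 0 <= V 1 by rewrite ltW//; exact: integrator1_gt0.
rewrite unlock /Lnorm.
have H : (\int[mu]_x (`|(EFin \o F) x| `^ 2) <= (c ^+ 2 * V 1)%:E)%E.
  rewrite EFinM -(dV_setT iV lV) -integral_cst//.
  apply: ae_ge0_le_integral => //.
  - by move=> x _; exact: poweR_ge0.
  - apply: (measurableT_comp (measurable_poweR _)).
    by apply: measurableT_comp => //; exact/measurable_EFinP.
  - by move=> x _; rewrite lee_fin sqr_ge0.
  - apply: filterS Fc => x Fx _.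
    by rewrite /= lee_fin powR_mulrn// ler_pXn2r ?nnegrE.
apply: le_trans (gt0_ler_poweR _ _ _ H) _; rewrite ?in_itv/= ?leey ?andbT//.
- by apply: integral_ge0 => x _; rewrite /= lee_fin powR_ge0.
- by rewrite lee_fin mulr_ge0// sqr_ge0.
rewrite lee_fin powR12_sqrt ?mulr_ge0 ?sqr_ge0//.
by rewrite sqrtrM ?sqr_ge0// sqrtr_sqr ger0_norm.
Qed.

Local Open Scope quotient_scope.

(** A function bounded on [0, 1[ is square integrable because dV is finite. The representative of
    its class is selected by choice, so it agrees with [F] only almost everywhere. *)
Lemma Lspace_of_fun (F : mR -> R) C : measurable_fun [set: mR] F ->
  (forall x, 0 <= x < 1 -> `|F x| <= C) ->
  exists u : L2V, \forall x \ae mu, (u : mR -> R) x = F x.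
Proof.
move=> mF FC.
have C0 : 0 <= C by apply: le_trans (FC 0 _); rewrite ?lexx ?ltr01.
pose F' : {mfun mR >-> measurableTypeR R} := @mfun_Sub _ _ mR mR F (mem_set mF).
pose q : {mfun_ mu, mR >-> measurableTypeR R} := \pi F'.
have qF : \forall x \ae mu, (q : mR -> R) x = F x.
  have /eqmodP/asboolP : repr q = F' %[mod {mfun_ mu, mR >-> measurableTypeR R}].
    by rewrite reprK.
  by apply: filterS => x /(_ Logic.I).
have q2 : finite_norm mu 2%E q.
  have qC : \forall x \ae mu, `|(q : mR -> R) x| <= C.
    by apply: filterS2 qF (dV_ae iV lV) => x -> /FC.
  apply: le_lt_trans (Lnorm2_le C0 _ qC) (ltry _).
  by have := @measurable_funP _ _ mR mR setT (repr q); exact.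
exists (LebesgueSpace.Pack (LebesgueSpace.Class
  (isFinLebesgue.Build _ _ _ _ _ (lee1n 2) q q2))).
exact: qF.
Qed.

Lemma Lspace_measurable (u : L2V) : measurable_fun [set: mR] (u : mR -> R).
Proof.
by have := @measurable_funP _ _ mR mR setT (repr (LebesgueSpace.sort u)); exact.
Qed.

Lemma Lspace_dist_le (u v : L2V) (F G : mR -> R) c : 0 <= c ->
  (\forall x \ae mu, (u : mR -> R) x = F x) ->
  (\forall x \ae mu, (v : mR -> R) x = G x) ->
  (forall x, 0 <= x < 1 -> `|F x - G x| <= c) ->
  mdist u v <= c * Num.sqrt (V 1).
Proof.
move=> c0 uF vG FG.
have uvc : ('N[dV iV lV]_2[EFin \o ((u : mR -> R) \- (v : mR -> R))%R] <=
    (c * Num.sqrt (V 1))%:E)%E.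
  apply: Lnorm2_le => //.
    by apply: measurable_funB; exact: Lspace_measurable.
  apply: filterS2 (filterI uF vG) (dV_ae iV lV) => x [/= -> ->]; exact: FG.
rewrite -lee_fin; apply: (le_trans _ uvc).
rewrite -[mdist u v]/(Lspace_dist u v) /Lspace_dist fineK//.
by rewrite ge0_fin_numE ?Lnorm_ge0 ?(le_lt_trans uvc (ltry _)).
Qed.

(** The bounds are pointwise, so they are asked of some function in the class rather than of its
    chosen representative. *)
Definition equibounded_class L C : set L2V :=
  [set u | exists2 F, equibounded W L C F &
    \forall x \ae mu, (u : mR -> R) x = F x].

Lemma equibounded_class_compact L C : 0 <= L -> compact (equibounded_class L C).
Proof.
move=> L0; rewrite compact_ultra => G GU GK.
have /choice[r rP] (u : L2V) : exists f, equibounded_class L C u ->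
    equibounded W L C f /\ \forall x \ae mu, (u : mR -> R) x = f x.
  have [[F SF uF]|nK] := pselect (equibounded_class L C u); first by exists F.
  by exists (fun=> 0) => /nK.
have GS : \forall u \near G, equibounded W L C (r u).
  by apply: filterS GK => u /rP[].
(* [l] is the pointwise limit along [G] of the selected good functions; only its values on [0, 1[
   are controlled. *)
have /choice[l lP] (x : R) : exists p : R, 0 <= x < 1 -> r u x @[u --> G] --> p.
  have [x01|nx] := pselect (0 <= x < 1); last by exists 0 => /nx.
  have [|p rp] := @ultrafilter_bounded_cvg _ G (r ^~ x) C GU _; last by exists p.
  by apply: filterS GS => u [_ + _]; exact.
have lC x : 0 <= x < 1 -> `|l x| <= C.
  move=> x01; apply: (cvgr_to_le (cvg_norm (lP _ x01))).
  by apply: filterS GS => u [_ + _]; exact.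
have lL : half_holder W L l.
  move=> x y x01 y01; have rl : (r u x - r u y) @[u --> G] --> l x - l y.
    by apply: cvgB; exact: lP.
  have rl2 : (r u x - r u y) ^+ 2 @[u --> G] --> (l x - l y) ^+ 2.
    by under eq_cvg do rewrite expr2; rewrite expr2; apply: cvgM.
  by apply: (cvgr_to_le rl2); apply: filterS GS => u [_ _]; exact.
(* [G] makes [r u] close to [l] at the finitely many points of a net, and the common Hoelder bound
   extends this to [0, 1[. *)
have unif e : 0 < e ->
    \forall u \near G, forall x, 0 <= x < 1 -> `|r u x - l x| <= e.
  move=> e0; have e3 : 0 < e / 3 by lra.
  have [s [s01 sP]] := half_holder_net rW L0 e3.
  have Gs : \forall u \near G, forall y, y \in s -> `|r u y - l y| < e / 3.
    elim: s s01 {sP} => [_|y s IH s01]; first exact: nearW.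
    have /IH : forall z, z \in s -> 0 <= z < 1.
      by move=> z zs; apply: s01; rewrite inE zs orbT.
    have y01 : 0 <= y < 1 by apply: s01; rewrite inE eqxx.
    have /cvgrPdist_lt/(_ _ e3) := lP _ y01.
    apply: filterS2 => u uy us z; rewrite inE => /predU1P[->|]; last exact: us.
    by rewrite distrC.
  apply: filterS2 GS Gs => u [_ _ Su] us x x01.
  by have := sP _ _ Su lL us x x01; rewrite mulrC divfK.
pose F x := if 0 <= x < 1 then l x else 0.
(* A limit along an ultrafilter need not be measurable; uniform convergence yields a sequence
   [r (U n)] with the same limit. *)
have mF : measurable_fun [set: mR] (F : mR -> R).
  have /choice[U UP] (n : nat) : exists u,
      measurable_fun [set: mR] (r u : mR -> R) /\
      forall x, 0 <= x < 1 -> `|r u x - l x| <= n.+1%:R^-1.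
    have n0 : (0 : R) < n.+1%:R^-1 by rewrite invr_gt0.
    by have [u [[mu_ _ _] ul]] := filter_ex (filterI GS (unif _ n0)); exists u.
  apply: (@measurable_fun_cvg _ mR R setT
      (fun n (x : mR) => if (0 : R) <= x < 1 then r (U n) x else 0)) => [n|x _].
    apply: measurable_fun_ifT => //; last by have [] := UP n.
    by apply: measurable_and; [exact: measurable_fun_ler|exact: measurable_fun_ltr].
  rewrite /F; case: ifPn => x01; last exact: cvg_cst.
  apply/cvgrPdist_lt => e e0; near=> n.
  apply: le_lt_trans (_ : n.+1%:R^-1 < e).
    by rewrite distrC; have [_] := UP n; exact.
  by near: n; exact: near_infty_natSinv_lt (PosNum e0).
have SF : equibounded W L C F.
  by split=> // [x x01|x y x01 y01]; rewrite /F ?x01 ?y01; [exact: lC|exact: lL].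
have [v vF] : exists v : L2V, \forall x \ae mu, (v : mR -> R) x = F x.
  by case: SF => _ FC _; exact: Lspace_of_fun FC.
exists v; split; first by exists F.
apply/fcvg_ballP => e e0; under eq_near do rewrite ballEmdist/=.
have V1 : 0 <= Num.sqrt (V 1) by exact: sqrtr_ge0.
(* A uniform error [d] costs at most [d * Num.sqrt (V 1)] in L^2, which is less than [e]. *)
pose d := e / (1 + Num.sqrt (V 1)).
have d0 : 0 < d by rewrite divr_gt0//; lra.
apply: filterS2 GK (unif _ d0) => u /rP[_ uP] ul.
apply: le_lt_trans (Lspace_dist_le (ltW d0) vF uP _) _ => [x x01|].
  by rewrite /F x01 distrC; exact: ul.
by rewrite /d mulrAC ltr_pdivrMr; nra.
Unshelve. all: by end_near. Qed.

End compactness.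

(** * Energetic balls lie in a compact set *)

Section embedding.
Context {R : realType} (W V : R -> R).
Hypotheses (iW : integrator W) (rW : cadlag W) (iV : integrator V) (lV : caglad V).
Local Notation mR := (measurableTypeR R).
Local Notation mu := (dV iV lV : {measure set mR -> \bar R}).
Local Notation L2V := (LspaceType2 (dV iV lV)).

Lemma Lspace_dist_lt (u v : L2V) (F : mR -> R) e : measurable_fun [set: mR] F ->
  (\forall x \ae mu, (v : mR -> R) x = F x) ->
  ('N[dV iV lV]_2[EFin \o (F \- (u : mR -> R))%R] < e%:E)%E ->
  mdist u v < e.
Proof.
move=> mF vF Fe; rewrite metric_sym -[mdist v u]/(Lspace_dist v u) /Lspace_dist.
have NE : ('N[dV iV lV]_2[EFin \o ((v : mR -> R) \- (u : mR -> R))%R] =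
    'N[dV iV lV]_2[EFin \o (F \- (u : mR -> R))%R])%E.
  rewrite unlock /Lnorm; apply: (congr1 (fun z => z `^ 2^-1)%E).
  have m2 (G : mR -> R) : measurable_fun [set: mR] G ->
      measurable_fun [set: mR] (fun x => `|(G x - (u : mR -> R) x)%R%:E| `^ 2)%E.
    move=> mG; apply: (measurableT_comp (measurable_poweR _)).
    apply: measurableT_comp => //; apply/measurable_EFinP.
    by apply: measurable_funB => //; exact: Lspace_measurable.
  apply: ae_eq_integral => //; [exact: m2 (Lspace_measurable v)|exact: m2|].
  by apply: filterS vF => x vFx _ /=; rewrite vFx.
rewrite NE -lte_fin fineK// ge0_fin_numE ?Lnorm_ge0//.
by apply: lt_trans Fe _; rewrite ltry.
Qed.

(** Far enough in an approximating sequence, the smooth functions are L^2-close to [u] and have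
    energy at most [L], so their classes are equibounded. *)
Lemma energetic_ball_closure M (u : L2V) : energetic_space W iV lV u ->
  energetic_norm W iV lV u <= M ->
  let L := (`|M| + 1) ^+ 2 in
  closure (equibounded_class W (iV := iV) (lV := lV) L
    (1 + 2 * L / V 1 + 2 * L * W 1)) u.
Proof.
move=> /(energetic_normP iW rW)[f_ [sf fu _] fN] NM L A /nbhs_ballP[e /= e0 eA].
(* The added 1 leaves room for the norms of [f_ n], which only converge to the norm of [u]; the
   absolute value allows a negative [M]. *)
have M1 : energetic_norm W iV lV u < `|M| + 1.
  by apply: (le_lt_trans NM); have := ler_norm M; lra.
have fM : \forall n \near \oo, smooth_norm W iV lV (f_ n) < `|M| + 1.
  exact: (cvgr_lt _ fN).
have fe : \forall n \near \oo,
    ('N[dV iV lV]_2[EFin \o (f_ n \- (u : R -> R))%R] < e%:E)%E.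
  have [finN N0] := (fine_cvgP _ _).1 fu.
  apply: filterS2 finN (cvgr_lt _ N0 _ e0) => n Nn Ne.
  by rewrite -(fineK Nn) lte_fin.
have [n [fMn fen]] := filter_ex (filterI fM fe).
have EL : energy_form W iV lV (f_ n) (f_ n) <= L.
  rewrite -[leLHS]sqr_sqrtr; last exact: energy_form_ge0.
  rewrite -smooth_normE// ler_pXn2r ?nnegrE ?(ltW fMn) ?addr_ge0//.
  exact: sqrtr_ge0.
have FL := energy_equibounded iW rW (sf n) EL.
have [v vF] : exists v : L2V, \forall x \ae mu, (v : mR -> R) x = f_ n x.
  by case: FL => mF FC _; exact: Lspace_of_fun FC.
exists v; split; first by exists (f_ n).
apply: eA; rewrite ballEmdist /=.
by apply: Lspace_dist_lt fen => //; case: FL.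
Qed.

End embedding.

Theorem theorem1p2p5 (R : realType) (W V : R -> R)
    (iW : integrator W) (rW : cadlag W) (iV : integrator V) (lV : caglad V) :
  compact_embedding (energetic_space W iV lV) (energetic_norm W iV lV).
Proof.
move=> B BH [M BM]; pose L := (`|M| + 1) ^+ 2.
have K : compact (equibounded_class W (iV := iV) (lV := lV) L
    (1 + 2 * L / V 1 + 2 * L * W 1)).
  by apply: equibounded_class_compact => //; exact: sqr_ge0.
have hL := @metric_hausdorff R (LspaceType2 (dV iV lV)).
apply: precompact_subset (compact_precompact hL K) => u Bu.
(* A compact set in a metric space is closed, so the compact set itself contains [B]. *)
rewrite ((closure_id _).1 (compact_closed hL K)).
exact: energetic_ball_closure (BH _ Bu) (BM _ Bu).
Qed.
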